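(* Let $(A,(G_I,G_T))$ be a contract over types $\mathsf{state}$ and $\mathsf{input}$. If there exists a natural number $n \ge 0$ such that $\mathsf{BaseCheck}(n)$ does not hold, then the contract $(A,(G_I,G_T))$ is not realizable.
   Context: Fix types (sets) $\mathsf{state}$ and $\mathsf{input}$; $s, s', s_j$ range over states and $i, i_j$ over inputs. No finiteness or decidability is assumed. A transition system is a pair $(I,T)$ of predicates $I$ on $\mathsf{state}$ (initial states) and $T$ on $\mathsf{state}\times\mathsf{input}\times\mathsf{state}$ (transitions; $T(s,i,s')$ means the system can move from $s$ to $s'$ on input $i$). A contract is a pair $(A,(G_I,G_T))$ where $A$ is a predicate on $\mathsf{state}\times\mathsf{input}$ (assumption), $G_I$ a predicate on $\mathsf{state}$ (initial guarantee), and $G_T$ a predicate on $\mathsf{state}\times\mathsf{input}\times\mathsf{state}$ (transitional guarantee). Given $(I,T)$ and $A$, the predicate $\mathsf{Reachable}_A$ on states is defined inductively (the least predicate) by $$\mathsf{Reachable}_A(s) = I(s) \lor \exists s_{p}, i.\ \mathsf{Reachable}_A(s_{p}) \land A(s_{p}, i) \land T(s_{p}, i, s).$$ A transition system $(I,T)$ is a realization of $(A,(G_I,G_T))$ when all of the following hold: 1. $\forall s.\ I(s) \Rightarrow G_I(s)$; 2. $\forall s,i,s'.\ \mathsf{Reachable}_A(s) \land A(s,i) \land T(s,i,s') \Rightarrow G_T(s,i,s')$; 3. $\exists s.\ I(s)$; 4. $\forall s,i.\ \mathsf{Reachable}_A(s) \land A(s,i) \Rightarrow \exists s'.\ T(s,i,s')$.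 A contract is realizable if there exists a transition system (over the same types) which is a realization of it. Finite viability: $\mathsf{Viable}_0(s)$ holds for every $s$, and $\mathsf{Viable}_{n}(s)$ is the formula $$\forall i_1.\ A(s,i_1) \Rightarrow \exists s_1.\ G_T(s,i_1,s_1) \land \bigl(\forall i_2.\ A(s_1,i_2) \Rightarrow \exists s_2.\ G_T(s_1,i_2,s_2) \land \cdots \land (\forall i_n.\ A(s_{n-1},i_n) \Rightarrow \exists s_n.\ G_T(s_{n-1},i_n,s_n))\cdots\bigr),$$ i.e. $\mathsf{Viable}_{n+1}(s) = \forall i.\ A(s,i) \Rightarrow \exists s'.\ G_T(s,i,s') \land \mathsf{Viable}_n(s')$. $\mathsf{BaseCheck}(n)$ is the statement $\exists s.\ G_I(s) \land \mathsf{Viable}_n(s)$. *)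

(* Defs.v *)
Set Implicit Arguments.

Record transition_system (state input : Type) : Type := TransitionSystem {
  init : state -> Prop;
  trans : state -> input -> state -> Prop
}.

Record contract (state input : Type) : Type := Contract {
  assumption : state -> input -> Prop;
  init_guarantee : state -> Prop;
  trans_guarantee : state -> input -> state -> Prop
}.

Inductive reachable (state input : Type) (M : transition_system state input)
    (A : state -> input -> Prop) : state -> Prop :=
| reachable_init : forall s, init M s -> reachable M A s
| reachable_step : forall sp i s,
    reachable M A sp -> A sp i -> trans M sp i s -> reachable M A s.

Record realization (state input : Type) (M : transition_system state input)
    (C : contract state input) : Prop := Realization {
  realization_init : forall s, init M s -> init_guarantee C s;
  realization_trans : forall s i s',
    reachable M (assumption C) s -> assumption C s i -> trans M s i s' ->
    trans_guarantee C s i s';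
  realization_init_nonempty : exists s, init M s;
  realization_progress : forall s i,
    reachable M (assumption C) s -> assumption C s i ->
    exists s', trans M s i s'
}.

Definition realizable (state input : Type) (C : contract state input) : Prop :=
  exists M : transition_system state input, realization M C.

Fixpoint finitely_viable (state input : Type) (C : contract state input)
    (n : nat) (s : state) : Prop :=
  match n with
  | 0 => True
  | S m => forall i, assumption C s i ->
      exists s', trans_guarantee C s i s' /\ finitely_viable C m s'
  end.

Definition base_check (state input : Type) (C : contract state input)
    (n : nat) : Prop :=
  exists s, init_guarantee C s /\ finitely_viable C n s.

(* Main.v *)
Require Import Defs.

(** A realization can answer every allowed input in a reachable state, with a move that meets the
    guarantee and stays reachable. Iterating gives [reachable_finitely_viable]; hence an initial
    state witnesses every [base_check], and one failing check excludes all realizations. *)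

Lemma reachable_finitely_viable (state input : Type)
    (M : transition_system state input) (C : contract state input) :
  realization M C ->
  forall (n : nat) (s : state),
    reachable M (assumption C) s -> finitely_viable C n s.
Proof.
  intros HM n.
  induction n as [|n IH]; intros s Hs; simpl.
  - exact I.
  - intros i Hi.
    destruct (realization_progress HM i Hs Hi) as [s' Ht].
    exists s'; split.
    + now apply (realization_trans HM).
    (* [IH] holds for all reachable states, so it applies to [s'], reachable because [i] is allowed
       in [s]. *)
    + apply IH.
      now apply reachable_step with s i.
Qed.

Theorem theorem2 (state input : Type) (C : contract state input) :
  (exists n : nat, ~ base_check C n) -> ~ realizable C.
Proof.
  intros [n Hn] [M HM].
  apply Hn.
  destruct (realization_init_nonempty HM) as [s Hs].
  exists s; split.
  - exact (realization_init HM s Hs).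
  - apply reachable_finitely_viable with M; [exact HM|].
    now apply reachable_init.
Qed.
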